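(* Let $\mathcal{P}\subseteq \mathbb{R}^3_{\geq 0}$ be a symmetric lattice polytope that is 2-partition maximal. If $\mathcal{P}$ is contained in a (2-dimensional affine) hyperplane of $\mathbb{R}^3$, then $\mathcal{P}$ has the integer decomposition property.
   Context: A lattice polytope in $\mathbb{R}^n$ is the convex hull of a nonempty finite set of points of $\mathbb{Z}^n$. A polytope $\mathcal{P}\subseteq\mathbb{R}^n$ is symmetric if $\pi\mathcal{P}=\mathcal{P}$ for every permutation $\pi$ of $\{1,\dots,n\}$, acting by permuting coordinates. For $t\in\mathbb{N}$ (positive integers), $t\mathcal{P}=\{tx : x\in\mathcal{P}\}$. $\mathcal{P}$ has the integer decomposition property (IDP) if for every $t\in\mathbb{N}$, every lattice point $x\in t\mathcal{P}\cap\mathbb{Z}^n$ can be written as $x=\sum_{i=1}^t x_i$ with $x_i\in\mathcal{P}\cap\mathbb{Z}^n$ (not necessarily distinct). A partition in $\mathbb{R}^n$ is a vector $\lambda=(\lambda_1,\dots,\lambda_n)\in\mathbb{Z}^n$ with $\lambda_1\geq\cdots\geq\lambda_n\geq 0$ (trailing zeros allowed); its size is $\lambda_1+\cdots+\lambda_n$. For partitions $\lambda,\mu$ of the same size, $\lambda\trianglelefteq\mu$ (dominance order) means $\sum_{i=1}^k\lambda_i\leq\sum_{i=1}^k\mu_i$ for all $k$; partitions of different sizes are incomparable. For a symmetric polytope $\mathcal{P}$, $\operatorname{LP}(\mathcal{P})$ is the set of lattice points of $\mathcal{P}$ that are partitions, and $\operatorname{MLP}(\mathcal{P})$ is the set of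 $\trianglelefteq$-maximal elements of $\operatorname{LP}(\mathcal{P})$. $\mathcal{P}$ is 2-partition maximal if there are two (distinct) partitions $\lambda,\mu$ with $\operatorname{MLP}(\mathcal{P})=\{\lambda,\mu\}$. *)

(* Defs.v *)
From mathcomp Require Import all_boot all_order all_algebra all_fingroup.
From mathcomp Require Import all_classical all_reals all_analysis.

Set Implicit Arguments.
Unset Strict Implicit.
Unset Printing Implicit Defensive.

Import Order.TTheory GRing.Theory Num.Theory.

Local Open Scope classical_set_scope.
Local Open Scope ring_scope.

Definition lattice (R : realType) (n : nat) : set 'rV[R]_n :=
  [set x | x \is a mxOver Num.int].

(* [convex_set] is stated on the alias [convex_lmodType] of a left module;
   [convex_hull A] is the intersection of all the convex sets containing A. *)
Definition convex_hull (R : realType) (n : nat) (A : set 'rV[R]_n) :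
    set 'rV[R]_n :=
  smallest (fun C : set 'rV[R]_n => @convex_set R 'rV[R]_n C) A.

Definition lattice_polytope (R : realType) (n : nat) (P : set 'rV[R]_n) : Prop :=
  exists V : set 'rV[R]_n,
    [/\ finite_set V, V !=set0, V `<=` @lattice R n & P = convex_hull V].

Definition symmetric_set (R : realType) (n : nat) (P : set 'rV[R]_n) : Prop :=
  forall s : 'S_n, col_perm s @` P = P.

Definition dilate (R : realType) (n : nat) (t : nat) (P : set 'rV[R]_n) :
    set 'rV[R]_n :=
  [set t%:R *: x | x in P].

Definition IDP (R : realType) (n : nat) (P : set 'rV[R]_n) : Prop :=
  forall t : nat, (0 < t)%N ->
  forall x : 'rV[R]_n, (dilate t P `&` @lattice R n) x ->
  exists y : 'I_t -> 'rV[R]_n,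
    (forall i, (P `&` @lattice R n) (y i)) /\ x = \sum_(i < t) y i.

Definition partition_vec (R : realType) (n : nat) (l : 'rV[R]_n) : Prop :=
  [/\ @lattice R n l,
      forall i j : 'I_n, (i <= j)%N -> l 0 j <= l 0 i &
      forall i : 'I_n, 0 <= l 0 i].

Definition vec_size (R : realType) (n : nat) (l : 'rV[R]_n) : R :=
  \sum_(i < n) l 0 i.

Definition dominated (R : realType) (n : nat) (l m : 'rV[R]_n) : Prop :=
  vec_size l = vec_size m /\
  forall k : nat, \sum_(i < n | (i < k)%N) l 0 i <= \sum_(i < n | (i < k)%N) m 0 i.

Definition LP (R : realType) (n : nat) (P : set 'rV[R]_n) : set 'rV[R]_n :=
  P `&` [set l | partition_vec l].

Definition MLP (R : realType) (n : nat) (P : set 'rV[R]_n) : set 'rV[R]_n :=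
  [set l | LP P l /\ forall m, LP P m -> dominated l m -> m = l].

Definition two_partition_maximal (R : realType) (n : nat) (P : set 'rV[R]_n) :
    Prop :=
  exists l m : 'rV[R]_n,
    [/\ partition_vec l, partition_vec m, l != m & MLP P = [set l; m]].

Definition nonneg_orthant (R : realType) (n : nat) : set 'rV[R]_n :=
  [set x | forall i : 'I_n, 0 <= x 0 i].

(* A genuine hyperplane only when [a != 0]. *)
Definition hyperplane (R : realType) (n : nat) (a : 'rV[R]_n) (b : R) :
    set 'rV[R]_n :=
  [set x | \sum_(i < n) a 0 i * x 0 i = b].

(* Main.v *)
Require Import Defs.
From mathcomp Require Import all_boot all_order all_algebra all_fingroup.
From mathcomp Require Import all_classical all_reals all_analysis.
From mathcomp Require Import ring.

(** The theorem is a case of the fact that lattice polygons have the integer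
    decomposition property; a polytope lying in a plane of three-space is a
    polygon, a segment or a point.

    It suffices to peel off one summand: given a lattice point x of (t+1)P,
    find a lattice point w of P with x - w in tP, then induct on t
    ([dilateS_split], [hyperplane_lattice_polytope_IDP]).  By Caratheodory's
    theorem in the plane ([caratheodory_plane]), x is a combination of three
    of the lattice points whose hull is P, say v_i, possibly repeated, with
    coefficients c_i >= 0 of sum t + 1.  If some c_i is at least 1, then w = v_i
    works.  Otherwise t + 1 < 3.  If t = 0, then w = x.  There remains t = 1,
    with all c_i < 1 and sum 2 ([twice_triangle_split]).

    In that case the reflected point y, the sum of all (1 - c_i) v_i, which is
    also v_1 + v_2 + v_3 - x, is a lattice point, and it lies in the triangle
    because the coefficients 1 - c_i are positive and of sum 1.  It cuts the
    triangle into three smaller ones, and x lies in the double of one of them.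
    Up to the same nonzero factor the areas of these triangles are absolute
    values of integer determinants, so this subdivision cannot go on forever.
    A degenerate triangle has an affine dependence, which can be used to make
    one coefficient vanish; the other two then have sum 2 and one of them is at
    least 1. *)

Set Implicit Arguments.
Unset Strict Implicit.
Unset Printing Implicit Defensive.

Import Order.TTheory GRing.Theory Num.Theory.
Local Open Scope classical_set_scope.
Local Open Scope ring_scope.

(** * Finite convex combinations *)

Lemma convex_set_segment (R : realType) (n : nat) (K : set 'rV[R]_n)
    (x y : 'rV[R]_n) (p : R) :
  @convex_set R 'rV[R]_n K -> K x -> K y -> 0 <= p -> p <= 1 ->
  K (p *: x + (1 - p) *: y).
Proof.
move=> cK Kx Ky p0 p1.
by have := cK x y (Itv01 p0 p1) (mem_set Kx) (mem_set Ky); rewrite inE.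
Qed.

Lemma convex_set_sum (R : realType) (n m : nat) (K : set 'rV[R]_n)
    (v : 'I_m -> 'rV[R]_n) (c : 'I_m -> R) :
  @convex_set R 'rV[R]_n K -> (forall i, K (v i)) -> (forall i, 0 <= c i) ->
  \sum_i c i = 1 -> K (\sum_i c i *: v i).
Proof.
move=> cK; elim: m => [|m IHm] in v c *.
  by rewrite big_ord0 => _ _ /eqP; rewrite eq_sym oner_eq0.
move=> Kv c0; rewrite !big_ord_recl.
have [c1|c1] := eqVneq (c ord0) 1.
  rewrite c1 => /eqP; rewrite -subr_eq0 addrAC subrr add0r.
  rewrite psumr_eq0 // => /allP cz; rewrite big1 ?addr0 ?scale1r // => i _.
  by have /eqP -> := cz i (mem_index_enum i); rewrite scale0r.
set S := \sum_(i < m) _ => cS.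
have S0 : 0 <= S by apply: sumr_ge0.
have SE : S = 1 - c ord0 by rewrite -cS addrC addKr.
have S_neq0 : S != 0 by rewrite SE subr_eq0 eq_sym.
have -> : \sum_(i < m) c (lift ord0 i) *: v (lift ord0 i) =
    (1 - c ord0) *: \sum_(i < m) (c (lift ord0 i) / S) *: v (lift ord0 i).
  rewrite scaler_sumr -SE; apply: eq_bigr => i _.
  by rewrite scalerA mulrC divfK.
apply: convex_set_segment => //; last by rewrite -subr_ge0 -SE.
apply: IHm => // [i|]; first by rewrite divr_ge0.
by rewrite -mulr_suml divff.
Qed.

(** The index set is nonempty so that [K] is inhabited: this is what makes the
    case [t = 0] true, where the dilate is the origin alone. *)
Lemma convex_set_sum_dilate (R : realType) (n m t : nat) (K : set 'rV[R]_n)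
    (v : 'I_m.+1 -> 'rV[R]_n) (c : 'I_m.+1 -> R) :
  @convex_set R 'rV[R]_n K -> (forall i, K (v i)) -> (forall i, 0 <= c i) ->
  \sum_i c i = t%:R -> dilate t K (\sum_i c i *: v i).
Proof.
move=> cK Kv c0 ct; case: t ct => [|t] ct.
  exists (v ord0) => //; rewrite scale0r big1 // => i _.
  have /eqP := ct; rewrite psumr_eq0 // => /allP cz.
  by have /eqP -> := cz i (mem_index_enum i); rewrite scale0r.
have t0 : t.+1%:R != 0 :> R by rewrite pnatr_eq0.
exists (\sum_i (c i / t.+1%:R) *: v i).
  apply: convex_set_sum => // [i|]; first by rewrite divr_ge0.
  by rewrite -mulr_suml ct divff.
rewrite scaler_sumr; apply: eq_bigr => i _.
by rewrite scalerA mulrC divfK.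
Qed.

(** Peeling off a vertex: the remaining coefficients are still nonnegative, and
    of sum [t]. *)
Lemma sub_vertex_dilate (R : realType) (n m t : nat) (K : set 'rV[R]_n)
    (v : 'I_m.+1 -> 'rV[R]_n) (c : 'I_m.+1 -> R) (k : 'I_m.+1) :
  @convex_set R 'rV[R]_n K -> (forall i, K (v i)) -> (forall i, 0 <= c i) ->
  \sum_i c i = t.+1%:R -> 1 <= c k ->
  dilate t K (\sum_i c i *: v i - v k).
Proof.
move=> cK Kv c0 ct ck.
have -> : \sum_i c i *: v i - v k = \sum_i (c i - (i == k)%:R) *: v i.
  under [RHS]eq_bigr do rewrite scalerBl.
  rewrite sumrB; congr (_ - _).
  rewrite (bigD1 k) //= eqxx scale1r big1 ?addr0 // => i /negPf ->.
  by rewrite scale0r.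
apply: convex_set_sum_dilate => // [i|].
  by case: eqP => [->|_]; rewrite ?subr0 // subr_ge0.
rewrite sumrB ct (bigD1 k) //= eqxx big1 ?addr0 => [|i /negPf -> //].
by rewrite -natr1 addrK.
Qed.

Lemma convex_hull_convex (R : realType) (n : nat) (A : set 'rV[R]_n) :
  @convex_set R 'rV[R]_n (convex_hull A).
Proof.
move=> x y p /set_mem hx /set_mem hy; apply/mem_set => C [cC AC].
by apply/set_mem/cC; apply/mem_set; [apply: hx|apply: hy].
Qed.

Lemma convex_hull_range (R : realType) (n m : nat) (v : 'I_m -> 'rV[R]_n) :
  convex_hull (range v) `<=`
  [set x | exists c : 'I_m -> R,
     [/\ forall i, 0 <= c i, \sum_i c i = 1 & x = \sum_i c i *: v i]].
Proof.
apply: smallest_sub => [x y p /set_mem[c [c0 c1 ->]] /set_mem[d [d0 d1 ->]]|].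
  apply/mem_set; exists (fun i => p%:num * c i + (1 - p%:num) * d i); split.
  - by move=> i; rewrite addr_ge0 // mulr_ge0 // subr_ge0.
  - by rewrite big_split /= -!mulr_sumr c1 d1; ring.
  - transitivity (p%:num *: (\sum_i c i *: v i) +
      (1 - p%:num) *: (\sum_i d i *: v i)) => //.
    rewrite !scaler_sumr -big_split; apply: eq_bigr => i _ /=.
    by rewrite [RHS]scalerDl !scalerA.
move=> _ [k _ <-]; exists (fun i => (i == k)%:R); split=> [i||].
- by rewrite ler0n.
- by rewrite (bigD1 k) //= eqxx big1 ?addr0 // => i /negPf ->.
- rewrite (bigD1 k) //= eqxx scale1r big1 ?addr0 // => i /negPf ->.
  by rewrite scale0r.
Qed.

(** * Affine dependences and Caratheodory's theorem in a plane *)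

(** Caratheodory's exchange step: moving the coefficients along an affine
    dependence changes neither their sum nor the point, and one may move until
    the first coefficient reaches zero. *)
Lemma affine_dependence_vanish (R : realType) (n m : nat)
    (v : 'I_m -> 'rV[R]_n) (c u : 'I_m -> R) :
  (forall i, 0 <= c i) -> \sum_i u i = 0 -> \sum_i u i *: v i = 0 ->
  (exists i, u i != 0) ->
  exists c' : 'I_m -> R,
    [/\ forall i, 0 <= c' i, \sum_i c' i = \sum_i c i,
        \sum_i c' i *: v i = \sum_i c i *: v i & exists k, c' k = 0].
Proof.
move=> c0 u0 uv [i0 ui0].
have [i1 ui1] : exists i, 0 < u i.
  apply: contrapT => /forallNP Nu.
  have Nu0 i : 0 <= - u i by rewrite oppr_ge0 leNgt; apply/negP/Nu.
  have : \sum_i - u i == 0 by rewrite sumrN u0 oppr0.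
  rewrite psumr_eq0 // => /allP /(_ i0 (mem_index_enum _)).
  by rewrite oppr_eq0 (negPf ui0).
(* The ratio test of the simplex method: only the entries with [0 < u i]
   decrease, and the smallest ratio tells which one vanishes first. *)
case: (@arg_minP _ _ _ i1 (fun i => 0 < u i) (fun i => c i / u i)) => // k uk mk.
set s := c k / u k in mk.
exists (fun i => c i - s * u i); split.
- move=> i; rewrite subr_ge0; have [ui|ui] := ltP 0 (u i).
    by rewrite -ler_pdivlMr // mk.
  by apply: le_trans (c0 i); rewrite mulr_ge0_le0 // divr_ge0 // ltW.
- by rewrite sumrB -mulr_sumr u0 mulr0 subr0.
- under eq_bigr do rewrite scalerBl -scalerA.
  by rewrite sumrB -scaler_sumr uv scaler0 subr0.
- by exists k; rewrite divfK ?subrr // gt_eqF.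
Qed.

Lemma hyperplane_comb (R : realType) (n m : nat) (a : 'rV[R]_n) (b : R)
    (v : 'I_m -> 'rV[R]_n) (c : 'I_m -> R) :
  (forall i, hyperplane a b (v i)) ->
  \sum_j a 0 j * (\sum_i c i *: v i) 0 j = (\sum_i c i) * b.
Proof.
move=> vH; under eq_bigr do rewrite summxE mulr_sumr.
rewrite exchange_big /= mulr_suml; apply: eq_bigr => i _.
rewrite -(vH i) mulr_sumr; apply: eq_bigr => j _.
by rewrite mxE mulrCA.
Qed.

(** Dropping the [k]-th coordinate is injective on a plane whose normal vector
    has a nonzero [k]-th entry.  Putting 1 in its place homogenizes the two other
    coordinates, so that the rows are linearly dependent exactly when the points
    of the plane are affinely dependent; for three points, the determinant is
    twice the signed area of the projected triangle. *)
Definition affine_chart (R : realType) (k : 'I_3) (m : nat)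
    (v : 'I_m -> 'rV[R]_3) : 'M[R]_(m, 3) :=
  \matrix_(i, j) if j == k then 1 else v i 0 j.

Lemma affine_chart_dependence (R : realType) (m : nat) (v : 'I_m -> 'rV[R]_3)
    (a : 'rV[R]_3) (b : R) (k : 'I_3) (u : 'rV[R]_m) :
  a 0 k != 0 -> (forall i, hyperplane a b (v i)) -> u *m affine_chart k v = 0 ->
  \sum_i u 0 i = 0 /\ \sum_i u 0 i *: v i = 0.
Proof.
move=> ak vH /rowP uM.
have u0 : \sum_i u 0 i = 0.
  have := uM k; rewrite !mxE => uM0.
  rewrite -[RHS]uM0; apply: eq_bigr => i _.
  by rewrite mxE eqxx mulr1.
split=> //; set w := \sum_i _.
(* The chart gives the vanishing of all coordinates but the [k]-th, and the
   equation of the plane gives the last one. *)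
have wj j : j != k -> w 0 j = 0.
  move=> jk; have := uM j; rewrite /w summxE !mxE => uM0.
  rewrite -[RHS]uM0; apply: eq_bigr => i _.
  by rewrite !mxE (negPf jk).
have wH : \sum_j a 0 j * w 0 j = 0.
  by rewrite (hyperplane_comb _ vH) u0 mul0r.
apply/rowP => j; rewrite [RHS]mxE; have [->|/wj //] := eqVneq j k.
move: wH; rewrite (bigD1 k) //= big1 ?addr0 => [/eqP|i /wj ->]; last first.
  by rewrite mulr0.
by rewrite mulf_eq0 (negPf ak) => /eqP.
Qed.

(** Four or more points have a chart with more rows than columns, hence an
    affine dependence, hence one of them can be dropped.  The sum of the
    coefficients is arbitrary because dilates of the convex hull are needed. *)
Lemma caratheodory_plane (R : realType) (m : nat) (v : 'I_m.+3 -> 'rV[R]_3)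
    (a : 'rV[R]_3) (b : R) (c : 'I_m.+3 -> R) :
  a != 0 -> (forall i, hyperplane a b (v i)) -> (forall i, 0 <= c i) ->
  exists (f : 'I_3 -> 'I_m.+3) (d : 'I_3 -> R),
    [/\ forall i, 0 <= d i, \sum_i d i = \sum_i c i &
        \sum_i d i *: v (f i) = \sum_i c i *: v i].
Proof.
move=> a0; elim: m => [|m IHm] in v c *; first by exists id, c.
move=> vH c0.
have /rV0Pn [k ak] := a0.
have : kermx (affine_chart k v) != 0.
  rewrite kermx_eq0 /row_free neq_ltn; apply/orP; left.
  exact: leq_ltn_trans (rank_leq_col _) _.
case/rowV0Pn => u /sub_kermxP uM u0.
have [su suv] := affine_chart_dependence ak vH uM.
have [c' [c'0 <- <- [i c'i]]] :=
  affine_dependence_vanish c0 su suv (elimT (rV0Pn _) u0).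
have [f [d [d0 sd sdv]]] :=
  IHm (v \o lift i) (c' \o lift i) (fun j => vH _) (fun j => c'0 _).
exists (lift i \o f), d; split=> //.
  by rewrite sd [RHS](bigD1_ord i) //= c'i add0r.
by rewrite sdv [RHS](bigD1_ord i) //= c'i scale0r add0r.
Qed.

(** * Lattice triangles *)

Lemma latticeB (R : realType) (n : nat) (x y : 'rV[R]_n) :
  lattice x -> lattice y -> lattice (x - y).
Proof.
move=> /mxOverP xZ /mxOverP yZ; apply/mxOverP => i j.
by rewrite !mxE rpredB.
Qed.

Lemma lattice_sum (R : realType) (n m : nat) (v : 'I_m -> 'rV[R]_n) :
  (forall i, lattice (v i)) -> lattice (\sum_i v i).
Proof.
move=> vZ; apply/mxOverP => i j; rewrite summxE; apply: rpred_sum => k _.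
by have /mxOverP := vZ k; exact.
Qed.

(** Replacing a vertex of a triangle by the point of barycentric coordinates [d]
    multiplies the signed area by the coordinate at that vertex.  The expansion
    along the row [k] works because both matrices have the same cofactors
    there. *)
Lemma det_row_comb (R : comNzRingType) (n : nat) (A B : 'M[R]_n) (k : 'I_n)
    (d : 'I_n -> R) :
  (forall i j, i != k -> B i j = A i j) ->
  (forall j, B k j = \sum_i d i * A i j) -> \det B = d k * \det A.
Proof.
move=> BA Bk; rewrite (expand_det_row B k).
have cofE j : cofactor B k j = \adj A j k.
  rewrite mxE /cofactor; congr (_ * \det _); apply/matrixP => i l.
  by rewrite !mxE BA // eq_sym neq_lift.
transitivity (\sum_i d i * (A *m \adj A) i k).
  under eq_bigr do rewrite Bk cofE mulr_suml.
  rewrite exchange_big /=; apply: eq_bigr => i _.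
  by rewrite mxE mulr_sumr; apply: eq_bigr => j _; rewrite mulrA.
rewrite mul_mx_adj (bigD1 k) //= mxE eqxx mulr1n big1 ?addr0 // => i ik.
by rewrite mxE (negPf ik) mulr0n mulr0.
Qed.

(** Areas of lattice triangles are discrete, so they can serve as a termination
    measure. *)
Lemma affine_chart_det_int (R : realType) (k : 'I_3) (v : 'I_3 -> 'rV[R]_3) :
  (forall i, @lattice R 3 (v i)) -> \det (affine_chart k v) \is a Num.int.
Proof.
move=> vZ; apply: rpred_sum => s _; apply: rpredM.
  by apply: rpredX; rewrite rpredN rpred1.
apply: rpred_prod => i _; rewrite mxE; case: ifP => _; first exact: rpred1.
by move: (vZ i) => /mxOverP.
Qed.

(** Pigeonhole for coefficients: this bounds the multiples for which a summand is
    not immediately found by the number of vertices. *)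
Lemma exists_ge1 (R : realDomainType) (m : nat) (c : 'I_m.+1 -> R) :
  m.+1%:R <= \sum_i c i -> exists i, 1 <= c i.
Proof.
move=> cm; apply/existsP; apply: contraLR cm => /existsPn c1.
have -> : m.+1%:R = \sum_(i < m.+1) 1 :> R by rewrite sumr_const card_ord.
rewrite -ltNge !big_ord_recl /=.
apply: ltr_leD; first by rewrite ltNge.
by apply: ler_sum => i _; rewrite ltW // ltNge.
Qed.

(** The only case where no vertex can be subtracted is the double of a triangle.
    The induction is on the area: the sum of the three vertices minus the
    given point is a lattice point of the triangle, and it replaces the vertex
    [l] that minimizes [c l / (1 - c l)], because the given point lies in the
    double of the subtriangle formed by this new point and the other two
    vertices. *)
Lemma twice_triangle_split (R : realType) (K : set 'rV[R]_3)
    (a : 'rV[R]_3) (b : R) (v : 'I_3 -> 'rV[R]_3) (c : 'I_3 -> R) :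
  @convex_set R 'rV[R]_3 K -> a != 0 ->
  (forall i, [/\ K (v i), lattice (v i) & hyperplane a b (v i)]) ->
  (forall i, 0 <= c i) -> \sum_i c i = 2%:R -> lattice (\sum_i c i *: v i) ->
  exists w, [/\ K w, lattice w & dilate 1 K (\sum_i c i *: v i - w)].
Proof.
move=> cK /rV0Pn [k ak].
have [N] : exists N : nat, N = Num.truncn `|\det (affine_chart k v)| by eexists.
elim/ltn_ind: N => N IHN in v c *; move=> NE vP c0 c2 xZ.
have vK i : K (v i) by case: (vP i).
have vZ i : lattice (v i) by case: (vP i).
have vH i : hyperplane a b (v i) by case: (vP i).
(* [e] need not be the given coefficients, since a degenerate triangle forces
   them to be changed. *)
have split_at (e : 'I_3 -> R) i : (forall i, 0 <= e i) -> \sum_i e i = 2%:R ->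
    \sum_i e i *: v i = \sum_i c i *: v i -> 1 <= e i ->
    exists w, [/\ K w, lattice w & dilate 1 K (\sum_i c i *: v i - w)].
  by move=> e0 e2 <- ei; exists (v i); split=> //; apply: sub_vertex_dilate.
have ge1_of_vanish (e : 'I_3 -> R) i : \sum_i e i = 2%:R -> e i = 0 ->
    exists j, 1 <= e j.
  move=> e2 ei; have [|j ej] := @exists_ge1 _ _ (e \o lift i).
    by move: e2; rewrite (bigD1_ord i) //= ei add0r => ->.
  by exists (lift i j).
have [[i ci]|/forallNP c_lt1] := pselect (exists i, 1 <= c i).
  exact: split_at ci.
have {}c_lt1 i : c i < 1 by rewrite ltNge; apply/negP/c_lt1.
have c_gt0 i : 0 < c i.
  rewrite lt0r c0 andbT; apply/eqP => /(ge1_of_vanish _ _ c2) [j].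
  by rewrite leNgt c_lt1.
(* A triangle of area zero cannot shrink; there the dependence between its
   vertices yields another combination with a coefficient at least 1. *)
have [/eqP/det0P [u u0 uM]|det_neq0] := eqVneq (\det (affine_chart k v)) 0.
  have [su suv] := affine_chart_dependence ak vH uM.
  have [e [e0 e2 ev [i ei]]] :=
    affine_dependence_vanish c0 su suv (elimT (rV0Pn _) u0).
  have [j ej] := ge1_of_vanish _ _ (etrans e2 c2) ei.
  by apply: split_at ej => //; rewrite e2.
pose d i := 1 - c i.
have d_gt0 i : 0 < d i by rewrite subr_gt0.
have d1 : \sum_i d i = 1.
  by rewrite sumrB sumr_const card_ord c2; ring.
set x := \sum_i c i *: v i in xZ *.
pose y := \sum_i d i *: v i.
have yE : y = \sum_i v i - x.
  rewrite /y; under eq_bigr do rewrite scalerBl scale1r.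
  by rewrite sumrB.
have yK : K y by apply: convex_set_sum => // i; exact: ltW.
have yZ : lattice y.
  by rewrite yE; apply: latticeB => //; exact: lattice_sum.
have yH : hyperplane a b y.
  by rewrite /hyperplane /= (hyperplane_comb _ vH) d1 mul1r.
(* Writing [x] with [s] times [y] leaves the coefficients [c i - s * d i] on the
   old vertices: the largest admissible [s] kills the one at [l]. *)
case: (@arg_minP _ _ _ ord0 predT (fun i => c i / d i)) => // l _ lP.
set s := c l / d l in lP.
have s0 : 0 <= s by rewrite divr_ge0 // ltW.
pose v' i := if i == l then y else v i.
pose c' i := if i == l then s else c i - s * d i.
have xE : \sum_i c' i *: v' i = x.
  transitivity (s *: y + \sum_i (c i - s * d i) *: v i).
    rewrite [in RHS](bigD1 l) //= divfK ?gt_eqF // subrr scale0r add0r.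
    rewrite (bigD1 l) //= /c' /v' eqxx; congr (_ + _).
    by apply: eq_bigr => i /negPf ->.
  under eq_bigr do rewrite scalerBl -scalerA.
  by rewrite sumrB -scaler_sumr addrC subrK.
have detE : \det (affine_chart k v') = d l * \det (affine_chart k v).
  apply: det_row_comb => [i j /negPf il|j]; first by rewrite !mxE /v' il.
  rewrite mxE /v' eqxx; under [in RHS]eq_bigr do rewrite mxE.
  case: eqP => _; first by rewrite -mulr_suml d1 mulr1.
  by rewrite /y summxE; apply: eq_bigr => i _; rewrite mxE.
have vP' i : [/\ K (v' i), lattice (v' i) & hyperplane a b (v' i)].
  by rewrite /v'; case: ifP.
rewrite -xE; apply: (IHN _ _ _ _ (erefl _) vP'); last by rewrite xE.
- rewrite NE -(ltr_nat R) !truncnK ?natr_norm_int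
    ?affine_chart_det_int //; last first.
    by move=> i; case: (vP' i).
  (* The area shrinks strictly because [d l = 1 - c l < 1]. *)
  rewrite detE normrM gtr_pMl ?normr_gt0 // gtr0_norm //.
  by rewrite ltrBlDr ltrDl.
- move=> i; rewrite /c'; case: ifP => // _.
  by rewrite subr_ge0 -ler_pdivlMr // lP.
- transitivity (s * \sum_i d i + \sum_i (c i - s * d i)).
    rewrite d1 [in RHS](bigD1 l) //= divfK ?gt_eqF // subrr add0r.
    rewrite (bigD1 l) //= /c' eqxx mulr1; congr (_ + _).
    by apply: eq_bigr => i /negPf ->.
  by rewrite d1 sumrB -mulr_sumr d1 c2; ring.
Qed.

(** * The integer decomposition property *)

Lemma dilateS_split (R : realType) (P : set 'rV[R]_3) (a : 'rV[R]_3) (b : R)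
    (t : nat) (x : 'rV[R]_3) :
  lattice_polytope P -> a != 0 -> P `<=` hyperplane a b ->
  dilate t.+1 P x -> lattice x ->
  exists w, [/\ P w, lattice w & dilate t P (x - w)].
Proof.
move=> [V [/finite_seqP [s Vs] [x0 Vx0] VZ PE]] a0 PH [p Pp <-] xZ.
have cP : @convex_set R 'rV[R]_3 P by rewrite PE; apply: convex_hull_convex.
have VP : V `<=` P by rewrite PE; apply: sub_gen_smallest.
(* The default value [x0] repeats a vertex, so that there are always at least
   three points. *)
pose v (i : 'I_(size s).+3) := nth x0 s i.
have vV i : V (v i).
  rewrite /v; have [is_|?] := ltnP i (size s); last by rewrite nth_default.
  by rewrite Vs /= mem_nth.
have Vv : V = range v.
  apply/seteqP; split=> [z|_ [i _ <-] //].
  rewrite Vs /= => zs; have is_ : (index z s < (size s).+3)%N.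
    by apply: (@leq_trans (size s)); rewrite ?index_mem //
      -[leqRHS]addn3 leq_addr.
  by exists (Ordinal is_) => //; rewrite /v /= nth_index.
have [c [c0 c1 pE]] : exists c : 'I_(size s).+3 -> R,
    [/\ forall i, 0 <= c i, \sum_i c i = 1 & p = \sum_i c i *: v i].
  by apply: convex_hull_range; rewrite -Vv -PE.
have vH i : hyperplane a b (v i) by apply/PH/VP/vV.
have tc0 i : 0 <= t.+1%:R * c i by rewrite mulr_ge0.
have [f [d [d0 dt dE]]] := caratheodory_plane a0 vH tc0.
rewrite -mulr_sumr c1 mulr1 in dt.
have {}dE : t.+1%:R *: p = \sum_i d i *: v (f i).
  rewrite dE pE scaler_sumr; apply: eq_bigr => i _.
  by rewrite scalerA.
have [[i di]|/forallNP d_lt1] := pselect (exists i, 1 <= d i).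
  exists (v (f i)); split; [exact/VP/vV|exact/VZ/vV|].
  by rewrite dE; apply: (sub_vertex_dilate cP) => // j; apply/VP/vV.
case: t => [|[|t]] in xZ tc0 dt dE *.
- exists (1 *: p); split=> //; first by rewrite scale1r.
  by exists p => //; rewrite subrr scale0r.
- rewrite dE in xZ *; apply: (twice_triangle_split cP a0) => // i.
  by split; [exact/VP/vV|exact/VZ/vV|].
- have [|i /d_lt1 //] := @exists_ge1 _ _ d.
  by rewrite dt ler_nat.
Qed.

Lemma hyperplane_lattice_polytope_IDP (R : realType) (P : set 'rV[R]_3)
    (a : 'rV[R]_3) (b : R) :
  lattice_polytope P -> a != 0 -> P `<=` hyperplane a b -> IDP P.
Proof.
move=> PV a0 PH t _ x [xt xZ].
elim: t => [|t IHt] in x xt xZ *.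
  case: xt => p _ <-; exists (fun=> 0); split=> [[]//|].
  by rewrite scale0r big_ord0.
have [w [Pw wZ /IHt]] := dilateS_split PV a0 PH xt xZ.
have xwZ : lattice (x - w) by apply: latticeB.
move=> /(_ xwZ) [y [yP yE]].
exists (fun i => if unlift ord0 i is Some j then y j else w); split=> [i|].
  by case: unliftP.
rewrite big_ord_recl unlift_none; under eq_bigr do rewrite liftK.
by rewrite -yE addrC subrK.
Qed.

Theorem theorem1p1 (R : realType) (P : set 'rV[R]_3)
    (P_ge0 : P `<=` @nonneg_orthant R 3)
    (P_lattice : lattice_polytope P)
    (P_sym : symmetric_set P)
    (P_2max : two_partition_maximal P)
    (P_plane : exists (a : 'rV[R]_3) (b : R), a != 0 /\ P `<=` hyperplane a b) :
  IDP P.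
Proof.
by have [a [b [a0 PH]]] := P_plane; apply: hyperplane_lattice_polytope_IDP a0 PH.
Qed.
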